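(* Let $\frac1p+\frac1q=1$. For any $0<\epsilon<\mathrm{diam}_p^p(S)\,\lambda$, Algorithm 1 (described in the context) finds an $\epsilon$-stationary point of $\min_{x\in S}\Phi(x)$ within $$N=\left\lceil\frac{2(\Phi(x^1)-\Phi^* )\,(\mathrm{diam}_p^p(S)\,\lambda)^{q-1}}{\epsilon^q}\right\rceil$$ steps; that is, for every sequence $(x^k)_{k\ge1}$ generated by the algorithm there is an index $1\le k\le\max\{1,N\}$ such that $x^k$ is an $\epsilon$-stationary point.
   Context: $S\subseteq\mathbf R^n$ is nonempty, compact and convex; $f:\mathbf R^n\to\mathbf R$ is differentiable (possibly nonconvex); $h:\mathbf R^n\to\mathbf R$ is convex (possibly nonsmooth); $\Phi=f+h$ and $\Phi^*=\min_{x\in S}\Phi(x)$. $\|v\|_p=(\sum_i|v_i|^p)^{1/p}$, $\mathrm{diam}_p(S)=\max_{x,y\in S}\|x-y\|_p$, $\mathrm{diam}_p^p(S)=(\mathrm{diam}_p(S))^p$. Standing assumption: $p>1$, $\lambda>0$ are such that $f(y)\le f(x)+\nabla f(x)^{\top}(y-x)+\frac{\lambda}{2}\|y-x\|_p^p$ for all $x,y\in S$. A point $x\in S$ is an $\epsilon$-stationary point of $\min_{x\in S}\Phi(x)$ if $\nabla f(x)^{\top}(y-x)+h(y)-h(x)\ge-\epsilon$ for all $y\in S$. Algorithm 1: start from $x^1\in S$. For $k=1,2,\dots$: choose $y^k\in\arg\min_{y\in S}\{f(x^k)+\nabla f(x^k)^{\top}(y-x^k)+h(y)\}$ and let $d^k=y^k-x^k$;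 choose $\alpha_k\in\arg\min_{\alpha\in[0,1]}\{\alpha\nabla f(x^k)^{\top}d^k+\alpha^p\frac{\lambda}{2}\|d^k\|_p^p+(1-\alpha)h(x^k)+\alpha h(y^k)\}$; set $x^{k+1}=(1-\alpha_k)x^k+\alpha_k y^k$. *)

(* Defs.v *)
From HB Require Import structures.
From mathcomp Require Import all_boot all_order all_algebra.
From mathcomp Require Import all_classical all_reals all_analysis.
Set Implicit Arguments.
Unset Strict Implicit.
Unset Printing Implicit Defensive.
Import Order.TTheory GRing.Theory Num.Theory.
Import numFieldNormedType.Exports.
Local Open Scope classical_set_scope.
Local Open Scope ring_scope.

Section definitions.
Context {R : realType} {n : nat}.
Local Notation V := 'rV[R]_n.
Implicit Types (S : set V) (f h : V -> R) (p lambda eps : R).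

Definition dotv (u v : V) : R := \sum_i u 0 i * v 0 i.

Definition gradient f (x : V) : V := \row_i 'D_(delta_mx 0 i) f x.

(* The library norm on 'rV[R]_n is the max norm. *)
Definition pnorm p (v : V) : R := (\sum_i `|v 0 i| `^ p) `^ p^-1.

(* For nonempty compact S this supremum is a maximum. *)
Definition pdiam p S : R := sup [set pnorm p (x - y) | x in S & y in S].

(* For Phi continuous and S nonempty compact this infimum is a minimum. *)
Definition min_value S (Phi : V -> R) : R := inf [set Phi x | x in S].

Definition argmin (T : Type) (A : set T) (F : T -> R) : set T :=
  [set x | A x /\ forall y, A y -> F x <= F y].

Definition growth_condition p lambda S f : Prop :=
  forall x y, S x -> S y ->
    f y <= f x + dotv (gradient f x) (y - x) + lambda / 2 * pnorm p (y - x) `^ p.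

Definition eps_stationary eps S f h (x : V) : Prop :=
  S x /\ forall y, S y -> - eps <= dotv (gradient f x) (y - x) + h y - h x.

(* Iterations are numbered from 1; entries at index 0 are unconstrained. *)
Definition conditional_gradient_run p lambda S f h
    (x y : nat -> V) (alpha : nat -> R) : Prop :=
  S (x 1%N) /\
  forall k, (1 <= k)%N ->
    let d := y k - x k in
    [/\ argmin S
          (fun z => f (x k) + dotv (gradient f (x k)) (z - x k) + h z) (y k),
        argmin [set a : R | 0 <= a <= 1]
          (fun a => a * dotv (gradient f (x k)) d
                    + a `^ p * (lambda / 2) * pnorm p d `^ p
                    + (1 - a) * h (x k) + a * h (y k)) (alpha k)
      & x k.+1 = (1 - alpha k) *: x k + alpha k *: y k].

Definition iteration_bound p q lambda eps S (Phi : V -> R) (x1 : V) : int :=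
  Num.ceil (2 * (Phi x1 - min_value S Phi)
              * (pdiam p S `^ p * lambda) `^ (q - 1) / eps `^ q).

End definitions.

(* Main.v *)
Require Import Defs.
From HB Require Import structures.
From mathcomp Require Import all_boot all_order all_algebra.
From mathcomp Require Import all_classical all_reals all_analysis.
From mathcomp Require Import ring lra.
Set Implicit Arguments.
Unset Strict Implicit.
Unset Printing Implicit Defensive.
Import Order.TTheory GRing.Theory Num.Theory.
Import numFieldNormedType.Exports.
Local Open Scope classical_set_scope.
Local Open Scope ring_scope.

(** Write Phi for f + h, L for lambda times the p-th power of the diameter of
    S, and call max over z in S of - (grad f x . (z - x) + h z - h x) the gap
    at x; a point of S is eps-stationary exactly when its gap is at most eps.
    The iterate y k attains the gap at x k.

    The growth condition and convexity of h bound Phi at the point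
    (1 - a) x k + a y k by the function of a that the line search minimizes
    ([composite_descent]).  So one step decreases Phi by at least
    a * gap - a^p * (L / 2) for every a in [0, 1], in particular for
    a = (eps / L)^(q - 1), the step at which a^(p - 1) * L = eps.  Where the
    gap exceeds eps, the decrease is thus larger than
    a * eps / 2 = eps^q / (2 * L^(q - 1)) ([conjugate_step],
    [nonstationary_decrease]).

    If none of the first K iterates were eps-stationary, Phi would drop by more
    than K times this amount, while the total drop cannot exceed
    Phi (x 1) - Phi^*; hence K < N, which is absurd for K = max 1 N.  This last
    step needs Phi to be bounded below on S.  That follows from the first
    subproblem having a solution, since this gives an affine lower bound for h
    on S ([composite_lower_bound]). *)

(** * The p-norm and the p-diameter *)

Lemma pnorm_powR (R : realType) n p (v : 'rV[R]_n) :
  p != 0 -> pnorm p v `^ p = \sum_i `|v 0 i| `^ p.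
Proof.
move=> p0; rewrite /pnorm -powRrM mulVf // powRr1 //.
by apply: sumr_ge0 => i _; exact: powR_ge0.
Qed.

Lemma pnormZ_powR (R : realType) n p a (v : 'rV[R]_n) :
  p != 0 -> 0 <= a -> pnorm p (a *: v) `^ p = a `^ p * pnorm p v `^ p.
Proof.
move=> p0 a0; apply: etrans (pnorm_powR (a *: v) p0) _.
rewrite pnorm_powR // mulr_sumr.
apply: eq_bigr => i _.
by rewrite mxE normrM ger0_norm // powRM.
Qed.

(** Compactness bounds the coordinates of the points of S, so that the supremum
    defining the diameter is taken over a bounded set. *)
Lemma pnorm_le_pdiam (R : realType) n p (S : set 'rV[R]_n) x y :
  0 < p -> compact S -> S x -> S y -> pnorm p (x - y) <= pdiam p S.
Proof.
move=> p0 cS Sx Sy; apply: ub_le_sup; last by exists x => //; exists y.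
have [M /= [_ normS]] := compact_bounded cS.
have coordS z i : S z -> `|z 0 i| <= M + 1.
  move=> Sz; apply: le_trans (normS (M + 1) _ z Sz); last by rewrite ltrDl.
  rewrite [leRHS]/Num.norm /= mx_normrE.
  by apply/bigmax_geP; right => /=; exists (0, i).
exists ((\sum_(i < n) (M + 1 + (M + 1)) `^ p) `^ p^-1).
move=> _ [z Sz [w Sw <-]]; apply: ge0_ler_powR.
- by rewrite invr_ge0 ltW.
- by rewrite nnegrE sumr_ge0 // => i _; exact: powR_ge0.
- by rewrite nnegrE sumr_ge0 // => i _; exact: powR_ge0.
apply: ler_sum => i _.
have zw : `|(z - w) 0 i| <= M + 1 + (M + 1).
  by rewrite !mxE (le_trans (ler_normB _ _)) // lerD // coordS.
by apply: ge0_ler_powR; rewrite ?nnegrE ?(le_trans _ zw) //; exact: ltW.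
Qed.

(** * The linear form of a gradient *)

Lemma dotvZr (R : realType) n a (u v : 'rV[R]_n) :
  dotv u (a *: v) = a * dotv u v.
Proof.
by rewrite /dotv mulr_sumr; apply: eq_bigr => i _; rewrite mxE mulrCA.
Qed.

Lemma dotv_continuous (R : realType) n (u w : 'rV[R]_n) :
  continuous (fun z : 'rV[R]_n => dotv u (z - w)).
Proof.
apply: continuous_big => [|i _ z]; first exact: add_continuous.
apply: (@continuousM _ _ (fun=> u 0 i) (fun z : 'rV[R]_n => (z - w) 0 i) z).
  exact: cst_continuous.
apply: (@continuous_comp _ _ _ (fun z : 'rV[R]_n => z - w)
  (fun M : 'rV[R]_n => M 0 i)).
  apply: (@continuousB _ _ _ id (fun=> w) z); first exact: cvg_id.
  exact: cst_continuous.
exact: coord_continuous.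
Qed.

(** * Lower bound for the objective *)

(** A solution y of the linearized subproblem shows that h stays above an
    affine function on S; the sum of f and that function is continuous, hence
    attains its minimum on S. *)
Lemma composite_lower_bound (R : realType) n (S : set 'rV[R]_n)
    (f h : 'rV[R]_n -> R) (c : R) (g w y : 'rV[R]_n) :
  S !=set0 -> compact S -> continuous f ->
  argmin S (fun z => c + dotv g (z - w) + h z) y ->
  has_lbound [set f z + h z | z in S].
Proof.
move=> S0 cS cf [Sy hy].
have cg : continuous (fun z : 'rV[R]_n => f z - dotv g (z - w)).
  move=> z; apply: (@continuousB _ R^o _ f (fun t => dotv g (t - w)) z).
    exact: cf.
  exact: dotv_continuous.
have [z0 _ z0min] : exists2 z0, z0 \in S & forall t, t \in S ->
    f z0 - dotv g (z0 - w) <= f t - dotv g (t - w).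
  by apply: EVT_min_rV => //; exact: continuous_subspaceT.
exists (f z0 - dotv g (z0 - w) + (dotv g (y - w) + h y)) => _ [z Sz <-].
by have := z0min z (mem_set Sz); have := hy z Sz; lra.
Qed.

(** * Decrease in one step *)

(** The step length is (eps / L)^(q - 1).  As q - 1 = 1 / (p - 1), it solves
    a^(p - 1) * L = eps, which makes the second term half of the first one. *)
Lemma conjugate_step (R : realType) (p q eps L : R) :
  1 < p -> p^-1 + q^-1 = 1 -> 0 < eps -> eps < L ->
  exists a, [/\ 0 < a, a <= 1 &
    a * eps - a `^ p * (L / 2) = eps `^ q / (2 * L `^ (q - 1))].
Proof.
move=> p1 pq e0 eL.
have p0 : 0 < p by lra.
have ip0 : 0 < p^-1 by rewrite invr_gt0.
have ip1 : p^-1 < 1 by rewrite invf_lt1.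
have q0 : 0 < q by rewrite -invr_gt0; lra.
have q1 : 1 < q by rewrite -invf_lt1 //; lra.
have pqE : q = (q - 1) * p.
  have -> : q = p / (p - 1).
    rewrite -[LHS]invrK (_ : q^-1 = 1 - p^-1); last by lra.
    by field; lra.
  by field; lra.
have L0 : 0 < L by lra.
have r0 : 0 < eps / L by rewrite divr_gt0.
have qm1 : 0 <= q - 1 by lra.
exists ((eps / L) `^ (q - 1)); split => //; first exact: powR_gt0.
  suff: (eps / L) `^ (q - 1) <= 1 `^ (q - 1) by rewrite powR1.
  apply: ge0_ler_powR; rewrite ?nnegrE //; first exact: ltW.
  by rewrite ler_pdivrMr // mul1r ltW.
rewrite -powRrM -pqE -(mulr_powRB1 (ltW r0) q0) -(mulr_powRB1 (ltW e0) q0).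
have invL : L^-1 `^ (q - 1) = (L `^ (q - 1))^-1.
  by rewrite -powR_inv1 ?ltW // powRAC powR_inv1 // powR_ge0.
rewrite powRM ?invr_ge0 ?ltW // invL.
have LL : L `^ (q - 1) != 0 by rewrite gt_eqF // powR_gt0.
by field; rewrite LL gt_eqF.
Qed.

Lemma convex_set_segment (R : realType) n (S : set 'rV[R]_n) (a : R) x y :
  convex_set S -> 0 <= a -> a <= 1 -> S x -> S y ->
  S ((1 - a) *: x + a *: y).
Proof.
move=> cS a0 a1 Sx Sy; rewrite addrC.
exact: set_mem (cS y x (Itv01 a0 a1) (mem_set Sy) (mem_set Sx)).
Qed.

Lemma convex_function_segment (R : realType) n (h : 'rV[R]_n -> R) (a : R) x y :
  convex_function [set: 'rV[R]_n] h -> 0 <= a -> a <= 1 ->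
  h ((1 - a) *: x + a *: y) <= (1 - a) * h x + a * h y.
Proof.
move=> ch a0 a1; rewrite [_ *: x + _]addrC [_ * h x + _]addrC.
by apply: (ch (Itv01 a0 a1) y x); rewrite in_setT.
Qed.

(** The objective along the segment [x, y] lies below the model that the line
    search minimizes: the remainder in the growth condition is homogeneous of
    degree p in the step, and h is below its chord. *)
Lemma composite_descent (R : realType) n (S : set 'rV[R]_n)
    (f h : 'rV[R]_n -> R) (p lambda a : R) x y :
  convex_set S -> convex_function [set: 'rV[R]_n] h -> p != 0 ->
  growth_condition p lambda S f -> S x -> S y -> 0 <= a -> a <= 1 ->
  let x' := (1 - a) *: x + a *: y in
  f x' + h x' <= f x + (a * dotv (gradient f x) (y - x)
     + a `^ p * (lambda / 2) * pnorm p (y - x) `^ p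
     + (1 - a) * h x + a * h y).
Proof.
move=> cS ch p0 gf Sx Sy a0 a1 /=; set x' := _ *: _ + _.
have x'Bx : x' - x = a *: (y - x).
  by rewrite /x' scalerBl scale1r scalerBr addrAC [x - _]addrC addrK addrC.
have fx' := gf x x' Sx (convex_set_segment cS a0 a1 Sx Sy).
rewrite x'Bx dotvZr (pnormZ_powR _ p0 a0) in fx'.
have hx' : h x' <= _ := convex_function_segment x y ch a0 a1.
lra.
Qed.

(** The exact line search does at least as well as the step length of
    [conjugate_step], and y, which attains the gap at x, makes the linear part
    of the model smaller than - eps times that step length.  The strict
    inequality comes from there. *)
Lemma nonstationary_decrease (R : realType) n (S : set 'rV[R]_n)
    (f h : 'rV[R]_n -> R) (p q lambda eps b : R) (x y : 'rV[R]_n) :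
  compact S -> convex_set S -> convex_function [set: 'rV[R]_n] h ->
  1 < p -> p^-1 + q^-1 = 1 -> 0 < lambda -> growth_condition p lambda S f ->
  0 < eps -> eps < pdiam p S `^ p * lambda ->
  S x -> ~ eps_stationary eps S f h x ->
  argmin S (fun z => f x + dotv (gradient f x) (z - x) + h z) y ->
  argmin [set a : R | 0 <= a <= 1]
    (fun a => a * dotv (gradient f x) (y - x)
              + a `^ p * (lambda / 2) * pnorm p (y - x) `^ p
              + (1 - a) * h x + a * h y) b ->
  let x' := (1 - b) *: x + b *: y in
  f x' + h x' <
  f x + h x - eps `^ q / (2 * (pdiam p S `^ p * lambda) `^ (q - 1)).
Proof.
move=> cS cvS ch p1 pq l0 gf e0 eL Sx nst [Sy ymin] [/andP[b0 b1] bmin] /=.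
set x' := _ *: _ + _.
have p0 : 0 < p by lra.
have gap : dotv (gradient f x) (y - x) + h y - h x < - eps.
  rewrite ltNge; apply/negP => gap_le; apply: nst; split=> // z Sz.
  by have := ymin z Sz; lra.
have [a [a0 a1 <-]] := conjugate_step p1 pq e0 eL.
have desc : f x' + h x' <= _ :=
  composite_descent cvS ch (lt0r_neq0 p0) gf Sx Sy b0 b1.
apply: le_lt_trans desc _.
have a01 : [set a : R | 0 <= a <= 1] a by rewrite /= (ltW a0).
have diamp : pnorm p (y - x) `^ p <= pdiam p S `^ p.
  have xy := pnorm_le_pdiam p0 cS Sy Sx.
  apply: ge0_ler_powR => //; rewrite ?nnegrE ?(ltW p0) ?powR_ge0 //.
  by apply: le_trans xy; exact: powR_ge0.
have quad : a `^ p * (lambda / 2) * pnorm p (y - x) `^ p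
            <= a `^ p * (pdiam p S `^ p * lambda / 2).
  rewrite -mulrA ler_wpM2l ?powR_ge0 // [leLHS]mulrC -[leRHS]mulrA.
  by rewrite ler_wpM2r // divr_ge0 // ltW.
have lin : a * (dotv (gradient f x) (y - x) + h y - h x) < a * - eps.
  by rewrite ltr_pM2l.
have := bmin a a01; lra.
Qed.

(** * Counting steps *)

(** At least one step is taken, so that the strict inequality survives the
    summation. *)
Lemma iterated_decrease (R : realDomainType) (u : nat -> R) d K :
  (forall k, (1 <= k <= K.+1)%N -> u k.+1 < u k - d) ->
  u K.+2 < u 1%N - K.+1%:R * d.
Proof.
elim: K => [|K IH] H; first by have := H 1%N isT; rewrite mul1r.
apply: (lt_trans (H _ _)); first by rewrite leqnn.
have : u K.+2 < u 1%N - K.+1%:R * d.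
  by apply: IH => k /andP[k1 kK]; apply: H; rewrite k1 (leqW kK).
by rewrite -[K.+2%:R]natr1; lra.
Qed.

Lemma run_in_set (R : realType) n (S : set 'rV[R]_n) f h (p lambda : R)
    x y alpha :
  convex_set S -> conditional_gradient_run p lambda S f h x y alpha ->
  forall k, (1 <= k)%N -> S (x k).
Proof.
move=> cS [Sx1 run]; elim=> // -[|k] IH _ //.
have [[Sy _] [/andP[a0 a1] _] ->] := run k.+1 isT.
by apply: convex_set_segment => //; exact: IH.
Qed.

Theorem theorem3p1 (R : realType) (n : nat) (S : set 'rV[R]_n)
    (f h : 'rV[R]_n -> R) (p q lambda : R)
    (S_neq0 : S !=set0) (S_compact : compact S) (S_convex : convex_set S)
    (f_diff : forall x : 'rV[R]_n, differentiable f x)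
    (h_convex : convex_function [set: 'rV[R]_n] h)
    (p_gt1 : 1 < p) (lambda_gt0 : 0 < lambda)
    (f_growth : growth_condition p lambda S f)
    (pq : p^-1 + q^-1 = 1)
    (eps : R) (eps_gt0 : 0 < eps) (eps_lt : eps < pdiam p S `^ p * lambda)
    (x y : nat -> 'rV[R]_n) (alpha : nat -> R)
    (run : conditional_gradient_run p lambda S f h x y alpha) :
  let N := iteration_bound p q lambda eps S (fun z => f z + h z) (x 1%N) in
  exists k : nat,
    (1 <= k)%N /\ k%:Z <= Num.max 1 N /\ eps_stationary eps S f h (x k).
Proof.
move=> N; apply: contrapT => no_stationary.
have Sx := run_in_set S_convex run.
have step := run.2.
set L := pdiam p S `^ p * lambda in eps_lt.
set d := eps `^ q / (2 * L `^ (q - 1)).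
have [K KE] : exists K : nat, K.+1%:Z = Num.max 1 N.
  have : 1 <= Num.max 1 N by rewrite le_max lexx.
  by case: (Num.max 1 N) => [[|K]|K] // _; exists K.
have dec k : (1 <= k <= K.+1)%N ->
    f (x k.+1) + h (x k.+1) < f (x k) + h (x k) - d.
  move=> /andP[k1 kK]; have [ymin amin ->] := step k k1.
  apply: (nonstationary_decrease (lambda := lambda)) => //; first exact: Sx.
  move=> st; apply: no_stationary; exists k; split=> //; split=> //.
  by rewrite -KE lez_nat.
have total := iterated_decrease (u := fun k => f (x k) + h (x k)) dec.
have f_cont : continuous f.
  by move=> z; exact/differentiable_continuous/f_diff.
have [y1min _ _] := step 1%N isT.
have Phi_lb : min_value S (fun z => f z + h z) <= f (x K.+2) + h (x K.+2).
  apply: ge_inf; last by exists (x K.+2) => //; exact: Sx.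
  exact: composite_lower_bound S_neq0 S_compact f_cont y1min.
have L0 : 0 < L by exact: lt_trans eps_lt.
have d0 : 0 < d by rewrite divr_gt0 ?mulr_gt0 ?powR_gt0.
have NK : N <= K.+1%:Z by rewrite KE le_max lexx orbT.
move: NK; rewrite /N /iteration_bound -/L ceil_le_int.
have -> : 2 * (f (x 1%N) + h (x 1%N) - min_value S (fun z => f z + h z))
    * L `^ (q - 1) / eps `^ q
  = (f (x 1%N) + h (x 1%N) - min_value S (fun z => f z + h z)) / d.
  by rewrite /d; field; rewrite !gt_eqF ?powR_gt0.
by rewrite ler_pdivrMr //= -pmulrn; lra.
Qed.
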